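(* Let $k\ge 2$, $n\ge 1$, and let $T_1:\mathcal{F}\to\mathsf{A}_1\subseteq\mathbb{R}^{k-1}$ be an elicitable functional with $\mathcal{F}$-consistent scoring functions $S_1,\dots,S_n:\mathsf{A}_1\times\mathsf{O}\to\mathbb{R}$. Define a second functional $$T_2:\mathcal{F}\to\mathsf{A}_2\subseteq\mathbb{R}^n,\qquad F\mapsto\big(\bar S_1(T_1(F),F),\dots,\bar S_n(T_1(F),F)\big)^\top .$$ If $S_1,\dots,S_n$ are all strictly $\mathcal{F}$-consistent for $T_1$, then the functional $T:\mathcal{F}\to\mathsf{A}_1\times\mathsf{A}_2$, $F\mapsto(T_1(F),T_2(F))^\top$, is elicitable. Moreover, $\mathcal{F}$-consistent scoring functions $S:(\mathsf{A}_1\times\mathsf{A}_2)\times\mathsf{O}\to\mathbb{R}$ for $T$ are given by $$S(x,y)=-\sum_{i=1}^n\partial_i f(x_k,\dots,x_{k+n-1})\big(S_i(x_1,\dots,x_{k-1},y)-x_{k+i-1}\big)-f(x_k,\dots,x_{k+n-1})+\sum_{i=1}^n c_i\,S_i(x_1,\dots,x_{k-1},y),$$ where $c\in\mathbb{R}^n$ and $f:\mathsf{A}_2\to\mathbb{R}$ is a differentiable and convex function such that $\partial_i f\le c_i$ holds for $i=1,\dots,n$. The function $S$ is strictly $\mathcal{F}$-consistent for $T$ if $S_1,\dots,S_n$ are strictly $\mathcal{F}$-consistent for $T_1$, $f$ is strictly convex, and $\partial_i f<c_i$ for $i=1,\dots,n$.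
   Context: $\mathsf{O}\subseteq\mathbb{R}^d$ is equipped with its Borel $\sigma$-algebra and $\mathcal{F}$ is a class of distribution functions of Borel probability measures on $\mathsf{O}$. A functional is a map $T:\mathcal{F}\to\mathsf{A}$ with $\mathsf{A}\subseteq\mathbb{R}^m$ for some $m$. A function $g:\mathsf{A}\times\mathsf{O}\to\mathbb{R}$ is $\mathcal{F}$-integrable if $g(x,\cdot)$ is integrable with respect to every $F\in\mathcal{F}$, for every $x\in\mathsf{A}$; then $\bar g(x,F):=\int_{\mathsf{O}}g(x,y)\,\mathrm{d}F(y)$. A scoring function is an $\mathcal{F}$-integrable function $S:\mathsf{A}\times\mathsf{O}\to\mathbb{R}$. It is $\mathcal{F}$-consistent for $T:\mathcal{F}\to\mathsf{A}$ if $\bar S(x,F)\ge\bar S(T(F),F)$ for all $x\in\mathsf{A}$, $F\in\mathcal{F}$; it is strictly $\mathcal{F}$-consistent for $T$ if in addition $\bar S(x,F)=\bar S(T(F),F)$ implies $x=T(F)$. The functional $T$ is elicitable if there exists a strictly $\mathcal{F}$-consistent scoring function for $T$. *)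

(* Defs.v *)
From HB Require Import structures.
From mathcomp Require Import all_boot all_order all_algebra.
From mathcomp Require Import all_classical all_reals all_analysis.
Set Implicit Arguments.
Unset Strict Implicit.
Unset Printing Implicit Defensive.
Import Order.TTheory GRing.Theory Num.Theory.
Import numFieldNormedType.Exports.
Local Open Scope classical_set_scope.
Local Open Scope ring_scope.

(* The subset [Om] of R^d as a space in its own right, with the topology induced
   by R^d; nonemptiness is needed because measurable types are pointed. *)
Definition subspace_of (R : realType) (d : nat) (Om : set 'rV[R]_d)
  (neOm : Om !=set0) : Type := set_type Om.

HB.instance Definition _ (R : realType) (d : nat) (Om : set 'rV[R]_d)
  (neOm : Om !=set0) := Topological.copy (subspace_of neOm) (set_type Om).
HB.instance Definition _ (R : realType) (d : nat) (Om : set 'rV[R]_d)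
    (neOm : Om !=set0) :=
  isPointed.Build (subspace_of neOm)
    (exist _ (projT1 (cid neOm)) (mem_set (projT2 (cid neOm)))).

Definition borel (R : realType) (d : nat) (Om : set 'rV[R]_d)
  (neOm : Om !=set0) := g_sigma_algebraType (@open (subspace_of neOm)).

HB.instance Definition _ (R : realType) (d : nat) (Om : set 'rV[R]_d)
  (neOm : Om !=set0) := Measurable.on (borel neOm).

(* A distribution function is identified with the probability measure it
   determines, so a class of distribution functions is a set [FF] of
   probability measures. Maps defined on [FF] or on an action domain [A] are
   total Rocq functions, constrained and evaluated only on [FF] and on [A]. *)
Section Elicitability.
Context (R : realType) (dOm : measure_display) (Om : measurableType dOm).
Variables (FF : set (probability Om R)) (m : nat) (A : set 'rV[R]_m).

Definition expected_score (g : 'rV[R]_m -> Om -> R) (x : 'rV[R]_m)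
  (F : probability Om R) : R := \int[F]_y g x y.

Definition scoring_function (S : 'rV[R]_m -> Om -> R) : Prop :=
  forall x, A x -> forall F, FF F -> F.-integrable setT (EFin \o S x).

Definition consistent (T : probability Om R -> 'rV[R]_m)
    (S : 'rV[R]_m -> Om -> R) : Prop :=
  scoring_function S /\
  forall x F, A x -> FF F -> expected_score S x F >= expected_score S (T F) F.

Definition strictly_consistent (T : probability Om R -> 'rV[R]_m)
    (S : 'rV[R]_m -> Om -> R) : Prop :=
  consistent T S /\
  forall x F, A x -> FF F ->
    expected_score S x F = expected_score S (T F) F -> x = T F.

Definition elicitable (T : probability Om R -> 'rV[R]_m) : Prop :=
  exists S, strictly_consistent T S.

End Elicitability.

Definition product_domain (R : realType) (m n : nat) (A1 : set 'rV[R]_m)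
    (A2 : set 'rV[R]_n) : set 'rV[R]_(m + n) :=
  [set x | A1 (lsubmx x) /\ A2 (rsubmx x)].

Definition partial (R : realType) (n : nat) (i : 'I_n) (f : 'rV[R]_n -> R)
  (z : 'rV[R]_n) : R := 'D_(delta_mx 0 i) f z.

(* [f : A -> R] differentiable; at a boundary point of [A] this means that [f]
   is extended to a neighbourhood and is differentiable at that point. *)
Definition differentiable_on (R : realType) (n : nat) (A : set 'rV[R]_n)
    (f : 'rV[R]_n -> R) : Prop :=
  forall z, A z -> differentiable f z.

(* The library's [convex_function] does not require the domain to be convex. *)
Definition convex_on (R : realType) (n : nat) (A : set 'rV[R]_n)
    (f : 'rV[R]_n -> R) : Prop :=
  convex_set A /\ convex_function A f.

Definition strictly_convex_on (R : realType) (n : nat) (A : set 'rV[R]_n)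
    (f : 'rV[R]_n -> R) : Prop :=
  convex_set A /\
  forall (t : R) (x y : 'rV[R]_n), A x -> A y -> x <> y -> 0 < t < 1 ->
    f (t *: x + (1 - t) *: y) < t * f x + (1 - t) * f y.

Definition combined_score (R : realType) (Om : Type) (m n : nat)
    (S : 'I_n -> 'rV[R]_m -> Om -> R) (c : 'rV[R]_n) (f : 'rV[R]_n -> R)
    (x : 'rV[R]_(m + n)) (y : Om) : R :=
  let u := lsubmx x in let z := rsubmx x in
  - (\sum_(i < n) partial i f z * (S i u y - z 0 i)) - f z
  + \sum_(i < n) c 0 i * S i u y.

(* Main.v *)
Require Import Defs.
From mathcomp Require Import all_boot all_order all_algebra.
From mathcomp Require Import all_classical all_reals all_analysis.
From mathcomp Require Import ring lra.
Import Order.TTheory GRing.Theory Num.Theory.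
Import numFieldNormedType.Exports.
Local Open Scope classical_set_scope.
Local Open Scope ring_scope.

(* Write [t = T2 F] and [E i u] for the expectation of [S_ i u] under [F], so
   that [t i = E i (T1 F)]. Expectation is linear, and for a report [(u, z)] the
   excess of the expected combined score over its value at [(T1 F, t)] is
     \sum_i (c i - d_i f z) * (E i u - E i (T1 F))
     + (f t - f z - \sum_i d_i f z * (t i - z i)).
   The first sum is nonnegative by consistency of the [S_ i], the second term by
   the gradient inequality for [f]. Under the strict hypotheses, the first
   vanishes only for [u = T1 F] and the second only for [z = t]. *)

(** * Expectation of an affine combination of integrable functions *)

Section AffineCombination.
Set Implicit Arguments.
Unset Strict Implicit.
Context (d : measure_display) (T : measurableType d) (R : realType).
Context (P : probability T R) (I : finType) (a : R) (w : I -> R).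
Context (h : I -> T -> R) (inth : forall i, P.-integrable setT (EFin \o h i)).

(** An arbitrary list [s] is allowed so that the tails met in the induction for [Rintegral_affine]
    are covered. *)
Let integrable_lin (s : seq I) :
  P.-integrable setT (EFin \o (fun y => \sum_(i <- s) w i * h i y)).
Proof.
rewrite (_ : _ \o _ = fun y => (\sum_(i <- s) (w i)%:E * (h i y)%:E)%E).
  by apply: integrable_sum => // i _; exact: (integrableZl measurableT (w i) (inth i)).
by apply/funext => y /=; rewrite -sumEFin; apply: eq_bigr.
Qed.

Let integrable_cst_prob : P.-integrable setT (EFin \o cst a).
Proof. exact: finite_measure_integrable_cst. Qed.

Lemma integrable_affine :
  P.-integrable setT (EFin \o (fun y => a + \sum_i w i * h i y)).
Proof.
rewrite (_ : _ \o _ =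
    (EFin \o cst a) \+ (EFin \o (fun y => \sum_i w i * h i y)%R))%E.
  exact: integrableD.
by apply/funext => y /=; rewrite EFinD.
Qed.

Lemma Rintegral_affine :
  \int[P]_y (a + \sum_i w i * h i y) = a + \sum_i w i * \int[P]_y h i y.
Proof.
rewrite (RintegralD measurableT integrable_cst_prob (integrable_lin _)).
rewrite Rintegral_cst// [X in _ * fine X]probability_setT mulr1; congr (_ + _).
elim: (index_enum I) => [|i s IHs].
  rewrite big_nil; under eq_Rintegral do rewrite big_nil.
  by rewrite Rintegral_cst// mul0r.
under eq_Rintegral do rewrite big_cons.
rewrite (RintegralD measurableT _ (integrable_lin s)); last first.
  exact: (integrableZl measurableT (w i) (inth i)).
by rewrite RintegralZl// IHs big_cons.
Qed.

End AffineCombination.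

(** * Gradient inequalities for convex functions *)

Section GradientInequality.
Set Implicit Arguments.
Unset Strict Implicit.
Context (R : realType) (n : nat).
Implicit Types (A : set 'rV[R]_n) (f : 'rV[R]_n -> R) (z t v : 'rV[R]_n).

(** Linearity of the differential, applied to the expansion of [v] in the standard basis. *)
Lemma sum_partial f z v : differentiable f z ->
  \sum_i partial i f z * v 0 i = 'D_v f z.
Proof.
move=> df; rewrite deriveE// [in RHS](matrix_sum_delta v) big_ord1 linear_sum/=.
by apply: eq_bigr => i _; rewrite linearZ/= /partial deriveE// mulrC.
Qed.

(** Convexity along the segment bounds each difference quotient with step [0 < h < 1] by
    [f t - f z]; the bound survives the limit as [h] decreases to 0. *)
Lemma derive_le_increment f z t : differentiable f z ->
  (forall h, 0 < h < 1 -> f (h *: t + (1 - h) *: z) <= h * f t + (1 - h) * f z) ->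
  'D_(t - z) f z <= f t - f z.
Proof.
move=> df conv_f.
have /cvg_dnbhs_at_right cvD := @diff_derivable _ _ _ f z (t - z) df.
apply: (cvgr_to_le cvD).
near=> h.
have h0 : 0 < h by [].
have h1 : h < 1 by near: h; exact: nbhs_right_lt.
rewrite /= -[_ *: _]/(h^-1 * _) ler_pdivrMl//.
have -> : h *: (t - z) + z = h *: t + (1 - h) *: z.
  by rewrite scalerBr scalerBl scale1r addrAC addrA.
by have := conv_f h; rewrite h0 h1 => /(_ isT); nra.
Unshelve. all: by end_near. Qed.

Lemma convex_on_segment_le A f z t h : convex_on A f -> A z -> A t -> 0 < h < 1 ->
  f (h *: t + (1 - h) *: z) <= h * f t + (1 - h) * f z.
Proof.
move=> [_ conv_f] Az At /andP[h0 h1].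
exact: (conv_f (Itv01 (ltW h0) (ltW h1)) t z (mem_set At) (mem_set Az)).
Qed.

Lemma convex_on_gradient_le A f z t : convex_on A f -> differentiable f z ->
  A z -> A t -> f z + \sum_i partial i f z * (t 0 i - z 0 i) <= f t.
Proof.
move=> conv_f df Az At.
have := derive_le_increment df (fun h => convex_on_segment_le conv_f Az At).
rewrite -sum_partial// lerBrDl.
by under eq_bigr do rewrite !mxE.
Qed.

Lemma strictly_convex_onW A f : strictly_convex_on A f -> convex_on A f.
Proof.
move=> [cA conv_f]; split=> // h x y /set_mem Ax /set_mem Ay.
(* Strict convexity speaks only of weights inside [(0, 1)] and distinct points; in the degenerate
   cases both sides agree. *)
have [->|h0] := eqVneq h 0%:i01; first by rewrite !conv0.
have [->|h1] := eqVneq h 1%:i01; first by rewrite !conv1.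
have [->|/eqP xy] := eqVneq x y; first by rewrite !convmm.
apply/ltW/conv_f => //.
by rewrite !lt_neqAle eq_sym h0 h1 ge0 le1.
Qed.

(* Applying the non-strict gradient inequality at the midpoint of [z] and [t]
   makes it strict at [t]. *)
Lemma strictly_convex_on_gradient_lt A f z t : strictly_convex_on A f ->
  differentiable f z -> A z -> A t -> z <> t ->
  f z + \sum_i partial i f z * (t 0 i - z 0 i) < f t.
Proof.
move=> sconv_f df Az At zt.
have [cA conv_f] := sconv_f.
have h2 : 0 < (2^-1 : R) < 1 by lra.
have h0 : 0 <= (2^-1 : R) by lra.
have h1 : (2^-1 : R) <= 1 by lra.
pose m : 'rV[R]_n := 2^-1 *: z + (1 - 2^-1) *: t.
have Am : A m.
  by apply/set_mem; exact: (cA z t (Itv01 h0 h1) (mem_set Az) (mem_set At)).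
have lem := convex_on_gradient_le (strictly_convex_onW sconv_f) df Az Am.
have ltm := conv_f _ _ _ Az At zt h2; rewrite -/m in ltm.
have sumE : \sum_i partial i f z * (m 0 i - z 0 i) =
    2^-1 * \sum_i partial i f z * (t 0 i - z 0 i).
  by rewrite mulr_sumr; apply: eq_bigr => i _; rewrite !mxE; field.
rewrite sumE in lem; lra.
Qed.

End GradientInequality.

(** * Consistency of scores built from subgradients *)

Section GradientScore.
Set Implicit Arguments.
Unset Strict Implicit.
Context (R : realType) (d : measure_display) (Om : measurableType d).
Context (FF : set (probability Om R)) (m n : nat).
Context (A1 : set 'rV[R]_m) (A2 : set 'rV[R]_n).
Context (T1 : probability Om R -> 'rV[R]_m) (S : 'I_n -> 'rV[R]_m -> Om -> R).
Hypothesis T1A1 : set_fun FF A1 T1.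
Hypothesis S_consistent : forall i, consistent FF A1 T1 (S i).

Let T2 (F : probability Om R) := \row_(i < n) expected_score (S i) (T1 F) F.
Let T F := row_mx (T1 F) (T2 F).
Hypothesis T2A2 : set_fun FF A2 T2.

Context (c : 'rV[R]_n) (f : 'rV[R]_n -> R) (g : 'I_n -> 'rV[R]_n -> R).

(* [combined_score] with the partial derivatives of [f] replaced by an
   arbitrary selection [g] of subgradients. *)
Definition subgradient_score (x : 'rV[R]_(m + n)) (y : Om) : R :=
  let u := lsubmx x in let z := rsubmx x in
  - (\sum_(i < n) g i z * (S i u y - z 0 i)) - f z
  + \sum_(i < n) c 0 i * S i u y.

(** For a fixed report the score is affine in the values [S i u y], which reduces its integrability
    and expectation to the affine case. *)
Let subgradient_scoreE x : subgradient_score x = fun y =>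
  (\sum_i g i (rsubmx x) * rsubmx x 0 i - f (rsubmx x)) +
  \sum_i (c 0 i - g i (rsubmx x)) * S i (lsubmx x) y.
Proof.
apply/funext => y; rewrite /subgradient_score -!sumrN addrAC [RHS]addrAC.
by congr (_ - _); rewrite -!big_split; apply: eq_bigr => i _ /=; ring.
Qed.

Let integrable_S u F i : A1 u -> FF F -> F.-integrable setT (EFin \o S i u).
Proof. by move=> A1u FFF; apply: (S_consistent i).1. Qed.

Lemma subgradient_score_integrable :
  scoring_function FF (product_domain A1 A2) subgradient_score.
Proof.
move=> x [A1x _] F FFF; rewrite subgradient_scoreE.
by apply: integrable_affine => i; exact: integrable_S.
Qed.

Lemma expected_subgradient_score x F : A1 (lsubmx x) -> FF F ->
  expected_score subgradient_score x F =
  (\sum_i g i (rsubmx x) * rsubmx x 0 i - f (rsubmx x)) +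
  \sum_i (c 0 i - g i (rsubmx x)) * expected_score (S i) (lsubmx x) F.
Proof.
move=> A1x FFF; rewrite {1}/expected_score subgradient_scoreE.
by rewrite Rintegral_affine// => i; exact: integrable_S.
Qed.

(** At the report [T F] the terms with [g] cancel in expectation, since the entries of [T2 F] are
    the expected scores at [T1 F]. *)
Lemma subgradient_score_gap x F : A1 (lsubmx x) -> FF F ->
  expected_score subgradient_score x F -
    expected_score subgradient_score (T F) F =
  \sum_i (c 0 i - g i (rsubmx x)) *
    (expected_score (S i) (lsubmx x) F - expected_score (S i) (T1 F) F) +
  (f (T2 F) -
    (f (rsubmx x) + \sum_i g i (rsubmx x) * (T2 F 0 i - rsubmx x 0 i))).
Proof.
move=> A1x FFF.
rewrite !expected_subgradient_score ?row_mxKl ?row_mxKr//; last exact: T1A1.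
under [X in _ = _ + (_ - (_ + X))]eq_bigr do rewrite mxE.
under [X in _ - (X - _ + _)]eq_bigr do rewrite mxE.
set a := \sum_i _; set b := \sum_i _; set p := \sum_i _; set q := \sum_i _.
set r := \sum_i _; set s := \sum_i _.
(* The values of [f] cancel; the remaining identity holds summand by summand. *)
suff : a + b - p - q = r - s by lra.
by rewrite -!sumrN -!big_split; apply: eq_bigr => i _ /=; ring.
Qed.

Let excess_ge0 i x F : A1 (lsubmx x) -> FF F -> A2 (rsubmx x) ->
  (forall j z, A2 z -> g j z <= c 0 j) -> 0 <=
    (c 0 i - g i (rsubmx x)) *
    (expected_score (S i) (lsubmx x) F - expected_score (S i) (T1 F) F).
Proof.
move=> A1x FFF A2x g_le; rewrite mulr_ge0 ?subr_ge0 ?g_le//.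
exact: (S_consistent i).2.
Qed.

Lemma subgradient_score_consistent :
  (forall i z, A2 z -> g i z <= c 0 i) ->
  (forall z t, A2 z -> A2 t -> f z + \sum_i g i z * (t 0 i - z 0 i) <= f t) ->
  consistent FF (product_domain A1 A2) T subgradient_score.
Proof.
move=> g_le f_le; split; first exact: subgradient_score_integrable.
move=> x F [A1x A2x] FFF; rewrite -subr_ge0 subgradient_score_gap//.
rewrite addr_ge0//; first by apply: sumr_ge0 => i _; exact: excess_ge0.
by rewrite subr_ge0 f_le//; exact: T2A2.
Qed.

Lemma subgradient_score_strictly_consistent : (0 < n)%N ->
  (forall i, strictly_consistent FF A1 T1 (S i)) ->
  (forall i z, A2 z -> g i z < c 0 i) ->
  (forall z t, A2 z -> A2 t -> z <> t ->
    f z + \sum_i g i z * (t 0 i - z 0 i) < f t) ->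
  strictly_consistent FF (product_domain A1 A2) T subgradient_score.
Proof.
move=> n_gt0 S_strict g_lt f_lt.
have g_le i z : A2 z -> g i z <= c 0 i by move=> /g_lt/ltW.
have f_le z t : A2 z -> A2 t -> f z + \sum_i g i z * (t 0 i - z 0 i) <= f t.
  move=> A2z A2t; have [->|/eqP zt] := eqVneq z t; last exact/ltW/f_lt.
  by rewrite big1 ?addr0// => i _; rewrite subrr mulr0.
split; first exact: subgradient_score_consistent.
move=> x F [A1x A2x] FFF /eqP; rewrite -subr_eq0 subgradient_score_gap//.
have A2T := T2A2 FFF.
rewrite paddr_eq0; last 2 first.
- by apply: sumr_ge0 => i _; exact: excess_ge0.
- by rewrite subr_ge0 f_le.
move=> /andP[/eqP sum0 /eqP fE].
(* One index suffices: its coefficient [c 0 i0 - g i0 z] is positive, so its excess vanishes and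
   strictness of [S i0] identifies [T1 F]. *)
pose i0 := Ordinal n_gt0.
have uE : lsubmx x = T1 F.
  apply: (S_strict i0).2 => //; apply/eqP; rewrite -subr_eq0.
  have /eqP := psumr_eq0P (fun i _ => excess_ge0 i A1x FFF A2x g_le) sum0
    (i := i0) isT.
  by rewrite mulf_eq0 gt_eqF// subr_gt0 g_lt.
have zE : rsubmx x = T2 F.
  apply: contrapT => /(f_lt _ _ A2x A2T); rewrite -subr_gt0.
  by rewrite fE ltxx.
by rewrite -[x]hsubmxK uE zE.
Qed.

End GradientScore.

(** * Tangent inequalities for the exponential witness *)

(** This is [1 + x < expR x] at [x = z - t], scaled by [expR (- z)]. *)
Lemma expRN_tangent_lt (R : realType) (z t : R) : z != t ->
  expR (- z) + - expR (- z) * (t - z) < expR (- t).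
Proof.
move=> zt; have -> : - t = - z + (z - t) by ring.
rewrite expRD -[X in X + _]mulr1 mulNr -mulrN -mulrDr ltr_pM2l ?expR_gt0//.
by rewrite opprB expR_gt1Dx// subr_eq0.
Qed.

Lemma expRN_tangent_le (R : realType) (z t : R) :
  expR (- z) + - expR (- z) * (t - z) <= expR (- t).
Proof.
have [->|zt] := eqVneq z t; first by rewrite subrr mulr0 addr0.
exact/ltW/expRN_tangent_lt.
Qed.

(** The scalar inequality is strict in a coordinate where [z] and [t] differ and weak in the
    others. *)
Lemma sum_expRN_tangent_lt (R : realType) (n : nat) (z t : 'rV[R]_n) : z <> t ->
  \sum_i expR (- z 0 i) + \sum_i - expR (- z 0 i) * (t 0 i - z 0 i) <
  \sum_i expR (- t 0 i).
Proof.
move=> zt; rewrite -big_split/=.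
have [j ztj] : exists j, z 0 j != t 0 j.
  apply: contrapT => /forallNP zt'; apply: zt; apply/rowP => i.
  by apply/eqP/negPn/negP; exact: zt'.
rewrite [ltLHS](bigD1 j)//= [ltRHS](bigD1 j)//= ltr_leD//.
  exact: expRN_tangent_lt.
by apply: ler_sum => i _; exact: expRN_tangent_le.
Qed.

Theorem proposition4p14 (R : realType) (d : nat) (Om : set 'rV[R]_d)
    (neOm : Om !=set0) (FF : set (probability (borel neOm) R))
    (k n : nat) (k_ge2 : (2 <= k)%N) (n_ge1 : (1 <= n)%N)
    (A1 : set 'rV[R]_(k - 1)) (A2 : set 'rV[R]_n)
    (T1 : probability (borel neOm) R -> 'rV[R]_(k - 1))
    (T1A1 : set_fun FF A1 T1)
    (T1_elicitable : elicitable FF A1 T1)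
    (S_ : 'I_n -> 'rV[R]_(k - 1) -> borel neOm -> R)
    (S_consistent : forall i, consistent FF A1 T1 (S_ i)) :
  let T2 := fun F : probability (borel neOm) R =>
    \row_(i < n) expected_score (S_ i) (T1 F) F in
  let T := fun F : probability (borel neOm) R => row_mx (T1 F) (T2 F) in
  let A := product_domain A1 A2 in
  set_fun FF A2 T2 ->
  [/\ (forall i, strictly_consistent FF A1 T1 (S_ i)) -> elicitable FF A T,
      forall (c : 'rV[R]_n) (f : 'rV[R]_n -> R),
        differentiable_on A2 f -> convex_on A2 f ->
        (forall i z, A2 z -> partial i f z <= c 0 i) ->
        consistent FF A T (combined_score S_ c f)
    & forall (c : 'rV[R]_n) (f : 'rV[R]_n -> R),
        (forall i, strictly_consistent FF A1 T1 (S_ i)) ->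
        differentiable_on A2 f -> strictly_convex_on A2 f ->
        (forall i z, A2 z -> partial i f z < c 0 i) ->
        strictly_consistent FF A T (combined_score S_ c f)].
Proof.
move=> T2 T A T2A2; split.
- (* [A2] need not be convex, so the witness uses the function
     [z |-> \sum_i exp (- z_i)], strictly convex on the whole space. *)
  move=> S_strict.
  exists (subgradient_score S_ 0 (fun z => \sum_i expR (- z 0 i))
    (fun i z => - expR (- z 0 i))).
  apply: subgradient_score_strictly_consistent => //.
  (* The choice [c = 0] is admissible because all slopes [- expR (- z 0 i)] are negative. *)
  + by move=> i z _; rewrite mxE oppr_lt0 expR_gt0.
  + by move=> z t _ _; exact: sum_expRN_tangent_lt.
- move=> c f df conv_f partial_le.
  (* With [g i := partial i f] the subgradient score is [combined_score] by conversion, so only the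
     gradient inequality is left to check. *)
  apply: (@subgradient_score_consistent _ _ _ _ _ _ A1 A2 T1 S_ T1A1
    S_consistent T2A2 c f (fun i => partial i f)) => //.
  by move=> z t A2z A2t; apply: (convex_on_gradient_le conv_f) => //; exact: df.
- move=> c f S_strict df conv_f partial_lt.
  apply: (@subgradient_score_strictly_consistent _ _ _ _ _ _ A1 A2 T1 S_ T1A1
    S_consistent T2A2 c f (fun i => partial i f)) => //.
  move=> z t A2z A2t.
  by apply: (strictly_convex_on_gradient_lt conv_f) => //; exact: df.
Qed.
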